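(* (a) Given a valuation measure $\overline{\mathbb{Q}}$ with respect to the basket, there exists a unique numéraire-consistent family of probability measures $(\mathbb{Q}_i)_{i=1}^d$ such that $\sum_i\mathbb{Q}_i\sim\overline{\mathbb{Q}}$ and $$\mathbb{E}^{\overline{\mathbb{Q}}}_r[\overline C]=\sum_{j\in\mathfrak{A}(r)}\overline S_j(r)\,\mathbb{E}^{\mathbb{Q}_j}_r\Big[\frac{C_j}{|\mathfrak{A}(T)|}\Big]\qquad( * )$$ for all $r\in[0,T]$ and all $C\in\mathcal{C}$ with $\overline C\in L^1(\overline{\mathbb{Q}})$. (b) Given a numéraire-consistent family of probability measures $(\mathbb{Q}_i)_{i=1}^d$, there exists a unique valuation measure $\overline{\mathbb{Q}}\sim\sum_i\mathbb{Q}_i$ with respect to the basket that satisfies $( * )$ for all $r\in[0,T]$ and all $C\in\mathcal{C}$ with $C_i\in L^1(\mathbb{Q}_i)$ for all $i$. (c) Let $\overline{\mathbb{Q}}$ be a valuation measure with respect to the basket, let $(\mathbb{Q}_i)_i$ be the family from (a), and fix $r\in[0,T]$. If $C\in\mathcal{C}$ satisfies $\overline C=\overline C\mathbf{1}_{\{i\in\mathfrak{A}(T)\}}$ $\overline{\mathbb{Q}}$-a.s. for some $i$, and $\overline C\in L^1(\overline{\mathbb{Q}})$, then $\mathbb{E}^{\overline{\mathbb{Q}}}_r[\overline C]=\overline S_i(r)\,\mathbb{E}^{\mathbb{Q}_i}_r[C_i]$.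
   Context: Fix $T>0$, $d\in\mathbb N$, and a filtered space $(\Omega,\mathcal{F}(T),(\mathcal{F}(t))_{t\in[0,T]})$ with right-continuous filtration and trivial $\mathcal{F}(0)$. For $x,y\in[0,\infty]$ the product $xy$ is defined except when one is $0$ and the other is $\infty$. An exchange matrix is $s=(s_{i,j})\in[0,\infty]^{d\times d}$ with $s_{i,i}=1$ and $s_{i,j}s_{j,k}=s_{i,k}$ for all $i,j,k$ whenever the product is defined. $S=(S_{i,j})_{i,j=1}^d$ is a right-continuous adapted $[0,\infty]^{d\times d}$-valued process such that $S(t)$ is an exchange matrix for every $t$. Active currencies: $\mathfrak{A}(t)=\{i:\sum_jS_{i,j}(t)<\infty\}$, with $\mathfrak A(0)=\{1,\dots,d\}$. Basket prices: $\overline S_i=1/\sum_jS_{i,j}\in[0,1]$. A value vector for an exchange matrix $s$ is $v\in[0,\infty]^d$ with $s_{i,j}v_j=v_i$ for all $i,j$ whenever the product is defined; $\mathcal{C}$ is the set of $\mathcal{F}(T)$-measurable value vectors for $S(T)$. For $C\in\mathcal{C}$, $\overline C=\frac{1}{|\mathfrak{A}(T)|}\sum_{j\in\mathfrak{A}(T)}\overline S_j(T)C_j$ (its value in units of the basket; it equals $\overline S_i(T)C_i$ for any $i\in\mathfrak A(T)$). A valuation measure with respect to the basket is a probability measure $\overline{\mathbb{Q}}$ on $(\Omega,\mathcal{F}(T))$ under which $\overline S=(\overline S_i)_i$ is a local martingale (equivalently, since bounded, a martingale). A family $(\mathbb{Q}_i)_{i=1}^d$ of probability measures on $(\Omega,\mathcal{F}(T))$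 is numéraire-consistent if $\mathbb{E}^{\mathbb{Q}_i}[S_{i,j}(t)\mathbf{1}_A]=S_{i,j}(0)\,\mathbb{Q}_j(A\cap\{S_{j,i}(t)>0\})$ for all $i,j$, $t\in[0,T]$, $A\in\mathcal{F}(t)$. $\mathbb{E}^{\mathbb Q}_r$ denotes conditional expectation under $\mathbb Q$ given $\mathcal F(r)$. *)

(* Defs.v *)
From HB Require Import structures.
From mathcomp Require Import all_boot all_order all_algebra.
From mathcomp Require Import all_classical all_reals all_analysis.
From mathcomp Require Import measurable_realfun.
Set Implicit Arguments. Unset Strict Implicit. Unset Printing Implicit Defensive.
Import Order.TTheory GRing.Theory Num.Theory.
Import numFieldNormedType.Exports.
Local Open Scope classical_set_scope.
Local Open Scope ring_scope.
Local Open Scope ereal_scope.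

Definition prod_defined (R : realType) (x y : \bar R) : Prop :=
  ~ (x = 0 /\ y = +oo) /\ ~ (x = +oo /\ y = 0).

Definition exchange_matrix (R : realType) (d : nat) (s : 'I_d -> 'I_d -> \bar R) : Prop :=
  (forall i j, 0 <= s i j) /\
  (forall i, s i i = 1) /\
  (forall i j k, prod_defined (s i j) (s j k) -> s i j * s j k = s i k).

Definition value_vector (R : realType) (d : nat) (s : 'I_d -> 'I_d -> \bar R)
  (v : 'I_d -> \bar R) : Prop :=
  (forall i, 0 <= v i) /\
  (forall i j, prod_defined (s i j) (v j) -> s i j * v j = v i).

Definition G_measurable (d0 : measure_display) (Omega : measurableType d0)
  (R : realType) (G : set (set Omega)) (f : Omega -> \bar R) : Prop :=
  forall B : set (\bar R), measurable B -> G (f @^-1` B).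

Definition G_measurable_real (d0 : measure_display) (Omega : measurableType d0)
  (R : realType) (G : set (set Omega)) (f : Omega -> R) : Prop :=
  forall B : set R, measurable B -> G (f @^-1` B).

Definition filtration (d0 : measure_display) (Omega : measurableType d0)
  (R : realType) (T : R) (F : R -> set (set Omega)) : Prop :=
  (forall t, (0 <= t <= T)%R -> sigma_algebra setT (F t)) /\
  (forall A, F T A <-> measurable A) /\
  (forall s t, (0 <= s <= t)%R -> (t <= T)%R -> F s `<=` F t) /\
  (forall t, (0 <= t < T)%R ->
     forall A, (forall u, (t < u <= T)%R -> F u A) -> F t A) /\
  (forall A, F 0%R A -> A = set0 \/ A = setT).

Definition activeb (d0 : measure_display) (Omega : measurableType d0)
  (R : realType) (d : nat) (S : R -> Omega -> 'I_d -> 'I_d -> \bar R)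
  (t : R) (w : Omega) (i : 'I_d) : bool :=
  (\sum_(j < d) S t w i j < +oo).

Definition nactive (d0 : measure_display) (Omega : measurableType d0)
  (R : realType) (d : nat) (S : R -> Omega -> 'I_d -> 'I_d -> \bar R)
  (t : R) (w : Omega) : nat :=
  #|[pred i : 'I_d | activeb S t w i]|.

Definition Sbar (d0 : measure_display) (Omega : measurableType d0)
  (R : realType) (d : nat) (S : R -> Omega -> 'I_d -> 'I_d -> \bar R)
  (t : R) (w : Omega) (i : 'I_d) : R :=
  match \sum_(j < d) S t w i j with
  | EFin r => r^-1
  | _ => 0%R
  end.

Definition exchange_process (d0 : measure_display) (Omega : measurableType d0)
  (R : realType) (T : R) (F : R -> set (set Omega)) (d : nat)
  (S : R -> Omega -> 'I_d -> 'I_d -> \bar R) : Prop :=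
  (forall t w, (0 <= t <= T)%R -> exchange_matrix (S t w)) /\
  (forall t i j, (0 <= t <= T)%R -> G_measurable (F t) (fun w => S t w i j)) /\
  (forall w i j t, (0 <= t < T)%R ->
     (fun u => S u w i j) @ t^'+ --> S t w i j) /\
  (forall w i, activeb S 0%R w i).

Definition claim (d0 : measure_display) (Omega : measurableType d0)
  (R : realType) (T : R) (d : nat) (S : R -> Omega -> 'I_d -> 'I_d -> \bar R)
  (C : Omega -> 'I_d -> \bar R) : Prop :=
  (forall i, measurable_fun setT (fun w => C w i)) /\
  (forall w, value_vector (S T w) (C w)).

Definition Cbar (d0 : measure_display) (Omega : measurableType d0)
  (R : realType) (d : nat) (S : R -> Omega -> 'I_d -> 'I_d -> \bar R) (T : R)
  (C : Omega -> 'I_d -> \bar R) (w : Omega) : \bar R :=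
  ((nactive S T w)%:R^-1)%:E *
  \sum_(j < d | activeb S T w j) ((Sbar S T w j)%:E * C w j).

Definition valuation_measure (d0 : measure_display) (Omega : measurableType d0)
  (R : realType) (T : R) (F : R -> set (set Omega)) (d : nat)
  (S : R -> Omega -> 'I_d -> 'I_d -> \bar R) (Q : probability Omega R) : Prop :=
  forall i,
    (forall t, (0 <= t <= T)%R -> G_measurable_real (F t) (fun w => Sbar S t w i)) /\
    (forall t, (0 <= t <= T)%R -> Q.-integrable setT (fun w => (Sbar S t w i)%:E)) /\
    (forall s t, (0 <= s <= t)%R -> (t <= T)%R -> forall A, F s A ->
       \int[Q]_(w in A) (Sbar S t w i)%:E = \int[Q]_(w in A) (Sbar S s w i)%:E).

Definition numeraire_consistent (d0 : measure_display) (Omega : measurableType d0)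
  (R : realType) (T : R) (F : R -> set (set Omega)) (d : nat)
  (S : R -> Omega -> 'I_d -> 'I_d -> \bar R) (Qs : 'I_d -> probability Omega R) : Prop :=
  forall i j t, (0 <= t <= T)%R -> forall A, F t A ->
    forall w0 : Omega,
      \int[Qs i]_(w in A) S t w i j =
      S 0%R w0 i j * Qs j (A `&` [set w | 0 < S t w j i]).

Definition equiv_sum (d0 : measure_display) (Omega : measurableType d0)
  (R : realType) (d : nat) (Qbar : probability Omega R)
  (Qs : 'I_d -> probability Omega R) : Prop :=
  forall A, measurable A -> (Qbar A = 0 <-> \sum_(i < d) Qs i A = 0).

(* Y is a version of the conditional expectation E^Q[X | G] (X >= 0) *)
Definition is_condexp (d0 : measure_display) (Omega : measurableType d0)
  (R : realType) (Q : probability Omega R) (G : set (set Omega))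
  (X Y : Omega -> \bar R) : Prop :=
  G_measurable G Y /\ (forall w, 0 <= Y w) /\
  (forall A, G A -> \int[Q]_(w in A) Y w = \int[Q]_(w in A) X w).

Definition star (d0 : measure_display) (Omega : measurableType d0)
  (R : realType) (T : R) (F : R -> set (set Omega)) (d : nat)
  (S : R -> Omega -> 'I_d -> 'I_d -> \bar R) (Qbar : probability Omega R)
  (Qs : 'I_d -> probability Omega R) (r : R) (C : Omega -> 'I_d -> \bar R) : Prop :=
  forall (Y : Omega -> \bar R) (Z : 'I_d -> Omega -> \bar R),
    is_condexp Qbar (F r) (Cbar S T C) Y ->
    (forall j, is_condexp (Qs j) (F r)
                 (fun w => C w j * ((nactive S T w)%:R^-1)%:E) (Z j)) ->
    {ae Qbar, forall w,
       Y w = \sum_(j < d | activeb S r w j) ((Sbar S r w j)%:E * Z j w)}.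

Definition same_family (d0 : measure_display) (Omega : measurableType d0)
  (R : realType) (d : nat) (Qs Qs' : 'I_d -> probability Omega R) : Prop :=
  forall i A, measurable A -> Qs i A = Qs' i A.

Definition same_measure (d0 : measure_display) (Omega : measurableType d0)
  (R : realType) (Q Q' : probability Omega R) : Prop :=
  forall A, measurable A -> Q A = Q' A.

Definition family_of (d0 : measure_display) (Omega : measurableType d0)
  (R : realType) (T : R) (F : R -> set (set Omega)) (d : nat)
  (S : R -> Omega -> 'I_d -> 'I_d -> \bar R) (Qbar : probability Omega R)
  (Qs : 'I_d -> probability Omega R) : Prop :=
  numeraire_consistent T F S Qs /\ equiv_sum Qbar Qs /\
  (forall r C, (0 <= r <= T)%R -> claim T S C ->
     Qbar.-integrable setT (Cbar S T C) -> star T F S Qbar Qs r C).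

Definition basket_of (d0 : measure_display) (Omega : measurableType d0)
  (R : realType) (T : R) (F : R -> set (set Omega)) (d : nat)
  (S : R -> Omega -> 'I_d -> 'I_d -> \bar R) (Qs : 'I_d -> probability Omega R)
  (Qbar : probability Omega R) : Prop :=
  valuation_measure T F S Qbar /\ equiv_sum Qbar Qs /\
  (forall r C, (0 <= r <= T)%R -> claim T S C ->
     (forall i, (Qs i).-integrable setT (fun w => C w i)) ->
     star T F S Qbar Qs r C).

(* Main.v *)
(** The time-zero basket prices c_j are constants summing to one.  The measure Qbar
    and the family (Q_j) determine each other through
      [c_j * Q_j(A) = \int_A Sbar_j(t) dQbar]   for all A in F(t),
    called [linked] below: Q_j has density Sbar_j(T)/c_j with respect to Qbar, and
    conversely Qbar is the mixture of the Q_j with weights c_j.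
    On active currencies Sbar_i S_ij = Sbar_j, so under [linked] the martingale
    property of the basket prices turns into numeraire consistency and back, and
    taking conditional expectations of Cbar = \sum_j Sbar_j(T) C_j / |A(T)| term
    by term gives the valuation formula.  Uniqueness: the valuation formula at time 0
    for the claim paying one unit of currency i on A says
    [\int_A Sbar_i(T) dQbar = c_i * Q_i(A)], which is [linked] at time T. *)

Require Import Defs.
From HB Require Import structures.
From mathcomp Require Import all_boot all_order all_algebra.
From mathcomp Require Import all_classical all_reals all_analysis.
From mathcomp Require Import measurable_realfun.
From mathcomp Require Import finmap.
Import Order.TTheory GRing.Theory Num.Theory.
Import numFieldNormedType.Exports.
Local Open Scope classical_set_scope.
Local Open Scope ring_scope.
Local Open Scope ereal_scope.
Set Implicit Arguments. Unset Strict Implicit. Unset Printing Implicit Defensive.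

(** * Exchange matrices *)

(** Because [fine +oo = 0] and [0^-1 = 0], an infinite row sum gives price zero without a case
    split. *)
Definition basket_price (R : realType) (d : nat) (s : 'I_d -> 'I_d -> \bar R)
  (i : 'I_d) : R := ((fine (\sum_(j < d) s i j))^-1)%R.

Definition active (R : realType) (d : nat) (s : 'I_d -> 'I_d -> \bar R)
  (i : 'I_d) : bool := \sum_(j < d) s i j < +oo.

Lemma SbarE d0 (Omega : measurableType d0) (R : realType) (d : nat)
    (S : R -> Omega -> 'I_d -> 'I_d -> \bar R) t w i :
  Sbar S t w i = basket_price (S t w) i.
Proof.
by rewrite /Sbar /basket_price; case: (\sum_(j < d) S t w i j) => //=; rewrite invr0.
Qed.

Lemma sume_lty_le (R : realType) (I : finType) (f : I -> \bar R) (i : I) :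
  (forall j, 0 <= f j) -> \sum_j f j < +oo -> f i < +oo.
Proof.
move=> f0; apply: le_lt_trans; rewrite (bigD1 i)//=.
by rewrite leeDl// sume_ge0.
Qed.

Section exchange_matrix_theory.
Context (R : realType) (d : nat) (s : 'I_d -> 'I_d -> \bar R).
Hypothesis hs : exchange_matrix s.

Lemma exch_ge0 i j : 0 <= s i j. Proof. by case: hs. Qed.
Lemma exch_diag i : s i i = 1. Proof. by case: hs => _ []. Qed.
Lemma exch_mul i j k : prod_defined (s i j) (s j k) -> s i j * s j k = s i k.
Proof. by case: hs => _ [_]; apply. Qed.

Lemma exch_mul_fin i j k : s i j < +oo -> s j k < +oo -> s i j * s j k = s i k.
Proof.
move=> ij jk; apply: exch_mul; split => -[e1 e2].
- by rewrite e2 ltxx in jk.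
- by rewrite e1 ltxx in ij.
Qed.

(** Otherwise the product [s i j * s j i] would be defined and infinite, although it must equal
    [s i i = 1]. *)
Lemma exch_pinfty i j : s i j = +oo -> s j i = 0.
Proof.
move=> sij; apply/eqP/negPn/negP => sji0.
have : s i j * s j i = s i i.
  by apply: exch_mul; split => -[]; rewrite sij// => _ /eqP; rewrite (negPf sji0).
have ji0 : 0 < s j i by rewrite lt0e sji0 exch_ge0.
by rewrite sij exch_diag gt0_mulye.
Qed.

Lemma exch_gt0 i j : (0 < s j i) = (s i j < +oo).
Proof.
apply/idP/idP => h.
  by rewrite ltey; apply/eqP => /exch_pinfty sji; rewrite sji ltxx in h.
have [sji|sji] := eqVneq (s j i) +oo; first by rewrite sji.
rewrite -ltey in sji; have := exch_mul_fin h sji; rewrite exch_diag => e.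
rewrite lt0e exch_ge0 andbT.
apply/eqP => sji0; move: e; rewrite sji0 mule0 => /eqP.
by rewrite eqe eq_sym oner_eq0.
Qed.

Lemma activeP i : reflect (forall j, s i j < +oo) (active s i).
Proof.
apply: (iffP idP) => [ai j|h]; first exact: sume_lty_le (exch_ge0 i) ai.
by apply/lte_sum_pinfty => j _; exact: h.
Qed.

(** A finite quote [s i j] against an active [j] makes the whole row of [i] finite, because
    [s i k = s i j * s j k]. *)
Lemma active_gt0 i j : active s j -> (0 < s j i) = active s i.
Proof.
move=> /activeP aj; rewrite exch_gt0; apply/idP/activeP => // ij k.
rewrite -(exch_mul_fin ij (aj k)).
by rewrite lte_mul_pinfty ?exch_ge0// ge0_fin_numE ?exch_ge0.
Qed.

(* A currency with the largest number of finite quotes is active. *)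
Lemma active_ex : (0 < d)%N -> exists i, active s i.
Proof.
move=> dgt0.
suff [i hi] : exists i, forall j, s i j < +oo by exists i; apply/activeP.
pose f i := #|[pred j | s i j < +oo]|.
have [i _ hi] := @arg_maxnP _ (Ordinal dgt0) xpredT f isT.
exists i => j; rewrite ltNge; apply/negP; rewrite leye_eq => /eqP sij.
have sji := exch_pinfty sij.
have : (f j <= f i)%N by exact: hi.
(* Since [s j i = 0], also [s j k = 0] wherever [s i k] is finite. Row [j] is thus finite at those
   places and also on its diagonal, against the maximality of [i]. *)
rewrite leqNgt => /negP; apply; apply: proper_card; apply/properP; split.
  apply/fintype.subsetP => k; rewrite !inE => ik.
  by rewrite -(@exch_mul_fin j i k) ?sji ?mul0e.
by exists j; rewrite !inE ?exch_diag ?ltry// sij ltxx.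
Qed.

Lemma exch_sum_ge1 i : 1 <= \sum_j s i j.
Proof.
rewrite (bigD1 i)//= exch_diag leeDl// sume_ge0// => j _; exact: exch_ge0.
Qed.

Lemma basket_price_ge0 i : (0 <= basket_price s i)%R.
Proof.
rewrite /basket_price invr_ge0 fine_ge0// sume_ge0// => j _; exact: exch_ge0.
Qed.

Lemma basket_price_inactive i : ~~ active s i -> basket_price s i = 0%R.
Proof.
by rewrite /active -leNgt leye_eq /basket_price => /eqP ->; rewrite invr0.
Qed.

Lemma active_sum_fin i : active s i -> \sum_j s i j \is a fin_num.
Proof.
by move=> ai; rewrite ge0_fin_numE// sume_ge0// => j _; exact: exch_ge0.
Qed.

Lemma basket_price_gt0 i : (0 < basket_price s i)%R = active s i.
Proof.
apply/idP/idP => [|ai].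
  by apply: contraTT => /basket_price_inactive ->; rewrite ltxx.
rewrite /basket_price invr_gt0 fine_gt0//; apply/andP; split => //.
exact: lt_le_trans (exch_sum_ge1 i).
Qed.

Lemma basket_price_le1 i : (basket_price s i <= 1)%R.
Proof.
have [ai|/basket_price_inactive ->//] := boolP (active s i).
rewrite /basket_price invf_le1 -?lee_fin ?fineK ?active_sum_fin ?exch_sum_ge1//.
by rewrite -invr_gt0 basket_price_gt0.
Qed.

(** The row sums of two active currencies differ by the factor [s i j]; for an inactive [j] both
    this quote and the price of [j] vanish. *)
Lemma basket_price_mul i j : active s i ->
  (basket_price s i)%:E * s i j = (basket_price s j)%:E.
Proof.
move=> ai; have [aj|naj] := boolP (active s j); last first.
  rewrite (basket_price_inactive naj); suff -> : s i j = 0 by rewrite mule0.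
  apply/eqP; rewrite -[_ == _]negbK; apply/negP => sij.
  have : 0 < s i j by rewrite lt0e sij exch_ge0.
  by rewrite active_gt0// (negbTE naj).
move/activeP : (ai) => fi; move/activeP : (aj) => fj.
have e : \sum_k s i k = s i j * \sum_k s j k.
  rewrite ge0_sume_distrr; last by move=> k _; exact: exch_ge0.
  by apply: eq_bigr => k _; rewrite exch_mul_fin.
have sijf : s i j \is a fin_num by rewrite ge0_fin_numE ?exch_ge0.
have bi : (0 < basket_price s i)%R by rewrite basket_price_gt0.
have bj : (0 < basket_price s j)%R by rewrite basket_price_gt0.
move: bi bj; rewrite /basket_price e fineM ?active_sum_fin// !invr_gt0.
rewrite -{3}(fineK sijf) -EFinM => bi bj; congr EFin.
have sij0 : fine (s i j) != 0%R.
  by apply/eqP => e0; rewrite e0 mul0r ltxx in bi.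
by rewrite invfM mulrC mulrA mulfV// mul1r.
Qed.

(** For an inactive [i] the convention [0 * +oo = 0] makes the left side zero, and either the
    indicator or the price of [j] vanishes on the right. This indicator is the one in numeraire
    consistency. *)
Lemma basket_price_mul_gt0 i j :
  (basket_price s i)%:E * s i j = (basket_price s j)%:E * (0 < s j i)%E%:R%:E.
Proof.
have [ai|nai] := boolP (active s i).
  rewrite basket_price_mul//; have [aj|naj] := boolP (active s j).
    by rewrite active_gt0// ai mule1.
  by rewrite (basket_price_inactive naj) mul0e.
rewrite (basket_price_inactive nai) mul0e.
have [aj|naj] := boolP (active s j).
  by rewrite active_gt0// (negbTE nai) mule0.
by rewrite (basket_price_inactive naj) mul0e.
Qed.

(** All prices are multiples [basket_price s i * s i j] of that of one active [i], whose row sum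
    cancels against its inverse. *)
Lemma basket_price_sum : (0 < d)%N -> (\sum_(j < d) basket_price s j = 1)%R.
Proof.
move=> /active_ex[i ai]; apply: EFin_inj; rewrite -sumEFin.
under eq_bigr => j _ do rewrite -(basket_price_mul j ai).
rewrite -ge0_sume_distrr; last by move=> k _; exact: exch_ge0.
rewrite /basket_price -{2}(fineK (active_sum_fin ai)) -EFinM mulVf//.
by rewrite gt_eqF// -invr_gt0 basket_price_gt0.
Qed.

(** Quotes between active currencies are positive and finite, so the conversion of [v] is defined
    even at a zero or infinite entry. *)
Lemma basket_value_active v i j : value_vector s v -> active s i -> active s j ->
  (basket_price s j)%:E * v j = (basket_price s i)%:E * v i.
Proof.
move=> [v0 hv] ai aj; rewrite -(basket_price_mul j ai) -muleA hv//.
have pij : 0 < s i j by rewrite active_gt0.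
have fij : s i j < +oo by move/activeP : ai.
split => -[e _]; first by rewrite e ltxx in pij.
by rewrite e ltxx in fij.
Qed.

Lemma exch_value_vector i : value_vector s (fun k => s k i).
Proof. by split => [k|k j h]; [exact: exch_ge0|exact: exch_mul]. Qed.

End exchange_matrix_theory.

(** * Integration over sub-sigma-algebras *)

Lemma measurable_indicE d0 (Omega : measurableType d0) (R : realType)
    (A : set Omega) :
  measurable A -> measurable_fun setT (fun w : Omega => (\1_A w : R)%:E).
Proof. by move=> mA; apply/measurable_EFinP; exact: measurable_indic. Qed.

Section sub_sigma_algebra.
Context d0 (Omega : measurableType d0) (R : realType) (G : set (set Omega)).
Hypothesis sG : sigma_algebra setT G.
Hypothesis GM : G `<=` measurable.

(** The carrier [Omega] with [G] as its sigma-algebra turns measurability for [G] into ordinary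
    [measurable_fun]. *)
Local Notation OmegaG := (g_sigma_algebraType G).

Lemma G_measurableP (h : Omega -> \bar R) :
  G_measurable G h <-> measurable_fun [set: OmegaG] h.
Proof.
split=> [mh _ B mB|mh B mB].
  by rewrite setTI measurable_g_measurableTypeE//; exact: mh.
have := mh measurableT B mB.
by rewrite setTI measurable_g_measurableTypeE.
Qed.

Lemma G_measurable_realP (h : Omega -> R) :
  G_measurable_real G h <-> measurable_fun [set: OmegaG] h.
Proof.
split=> [mh _ B mB|mh B mB].
  by rewrite setTI measurable_g_measurableTypeE//; exact: mh.
have := mh measurableT B mB.
by rewrite setTI measurable_g_measurableTypeE.
Qed.

Lemma sub_measurable_fun d' (V : measurableType d') (h : Omega -> V) :
  measurable_fun [set: OmegaG] h -> measurable_fun [set: Omega] h.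
Proof.
move=> mh _ B mB; apply: GM; have := mh measurableT B mB.
by rewrite measurable_g_measurableTypeE.
Qed.

Lemma G_measurable_fun (h : Omega -> \bar R) :
  G_measurable G h -> measurable_fun [set: Omega] h.
Proof. by move/G_measurableP; exact: sub_measurable_fun. Qed.

Lemma G_measurableM (f g : Omega -> \bar R) :
  G_measurable G f -> G_measurable G g -> G_measurable G (fun w => f w * g w).
Proof.
by move=> /G_measurableP mf /G_measurableP mg; apply/G_measurableP; exact: emeasurable_funM.
Qed.

Lemma G_measurable_sum (I : Type) (s : seq I) (f : I -> Omega -> \bar R) :
  (forall i, G_measurable G (f i)) -> G_measurable G (fun w => \sum_(i <- s) f i w).
Proof.
move=> mf; apply/G_measurableP; apply: (@emeasurable_sum _ OmegaG) => i.
exact/G_measurableP.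
Qed.

Lemma G_measurable_EFin (f : Omega -> R) :
  G_measurable_real G f -> G_measurable G (fun w => (f w)%:E).
Proof.
by move=> /G_measurable_realP mf; apply/G_measurableP/(@measurable_EFinP _ OmegaG).
Qed.

Lemma G_measurable_indic (A : set Omega) :
  G A -> G_measurable G (fun w => (\1_A w : R)%:E).
Proof.
move=> GA; apply/G_measurableP; apply: (@measurable_indicE _ OmegaG).
by rewrite measurable_g_measurableTypeE.
Qed.

Lemma G_measurable_cst (x : \bar R) : G_measurable G (cst x).
Proof. by apply/G_measurableP; exact: measurable_cst. Qed.

(** On nonnegative reals inversion is the measurable power function of exponent [-1], the value
    [0^-1 = 0] included. *)
Lemma G_measurable_inv (f : Omega -> R) : (forall w, 0 <= f w)%R ->
  G_measurable_real G f -> G_measurable_real G (fun w => (f w)^-1)%R.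
Proof.
move=> f0 /G_measurable_realP mf; apply/G_measurable_realP.
have -> : (fun w => (f w)^-1)%R = (fun x : R => x `^ (-1))%R \o f.
  by apply/funext => w /=; rewrite powR_inv1.
by apply: (measurableT_comp _ mf); exact: measurable_powR.
Qed.

Lemma G_measurable_fine (f : Omega -> \bar R) :
  G_measurable G f -> G_measurable_real G (fun w => fine (f w)).
Proof.
move=> /G_measurableP mf; apply/G_measurable_realP.
by apply: (measurableT_comp _ mf); exact: fine_measurable.
Qed.

Lemma G_measurable_lt (f : Omega -> \bar R) (x : \bar R) :
  G_measurable G f -> G [set w | f w < x].
Proof.
move=> mf; have -> : [set w | f w < x] = f @^-1` `]-oo, x[%classic.
  by apply/seteqP; split => w /=; rewrite in_itv.
exact/mf/emeasurable_itv.
Qed.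

Lemma G_measurable_gt (f : Omega -> \bar R) (x : \bar R) :
  G_measurable G f -> G [set w | x < f w].
Proof.
move=> mf; have -> : [set w | x < f w] = f @^-1` `]x, +oo[%classic.
  by apply/seteqP; split => w /=; rewrite in_itv/= andbT.
exact/mf/emeasurable_itv.
Qed.

Import HBNNSimple.

(* The only place where functions measurable for a sub-sigma-algebra are
   approximated by simple functions; all changes of measure reduce to it. *)
Lemma ge0_integralM_eq (mu nu : {measure set Omega -> \bar R})
    (f g h : Omega -> \bar R) :
  measurable_fun setT f -> measurable_fun setT g ->
  (forall w, 0 <= f w) -> (forall w, 0 <= g w) ->
  (forall A, G A -> \int[mu]_(w in A) f w = \int[nu]_(w in A) g w) ->
  G_measurable G h -> (forall w, 0 <= h w) ->
  \int[mu]_w (h w * f w) = \int[nu]_w (h w * g w).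
Proof.
move=> mf mg f0 g0 fg /G_measurableP mh h0.
(* Approximating inside [OmegaG] puts every level set of [a n] into [G], where the hypothesis [fg]
   applies. *)
pose a := @nnsfun_approx _ OmegaG R setT measurableT h mh.
have ma n : measurable_fun [set: Omega] (a n : Omega -> R).
  by apply: sub_measurable_fun; exact/measurable_funP.
have a_nd w m n : (m <= n)%N -> (a m w <= a n w)%R.
  by move=> mn; have /lefP := nd_nnsfun_approx measurableT mh mn; exact.
have step (m : {measure set Omega -> \bar R}) (k : Omega -> \bar R) :
    measurable_fun setT k -> (forall w, 0 <= k w) ->
    \int[m]_w (h w * k w) = limn (fun n => \int[m]_w ((a n w)%:E * k w)).
  move=> mk k0; rewrite -monotone_convergence//; last 3 first.
  - by move=> n; apply: emeasurable_funM => //; exact/measurable_EFinP.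
  - by move=> n w _; rewrite mule_ge0// lee_fin.
  - by move=> w _ m' n' mn; rewrite lee_wpmul2r// lee_fin; exact: a_nd.
  apply: eq_integral => w _; apply/esym/cvg_lim => //.
  have ch : (a n w)%:E @[n --> \oo] --> h w.
    exact: (@cvg_nnsfun_approx _ OmegaG R setT measurableT h mh (fun x _ => h0 x)).
  (* Multiplication is discontinuous at [0 * +oo], so zero factors are treated apart: if [h w = 0],
     then [a n w <= h w] makes all approximants zero; if [k w = 0], all products are zero. *)
  have [hw0|hw0] := eqVneq (h w) 0.
    rewrite hw0 mul0e; suff an n : a n w = 0%R.
      by under eq_fun do rewrite an mul0e; exact: cvg_cst.
    have : (a n w)%:E <= h w.
      by rewrite /a nnsfun_approxE; apply: (@le_approx _ OmegaG).
    by rewrite hw0 lee_fin => an0; apply/eqP; rewrite eq_le fun_ge0 an0.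
  have [kw0|kw0] := eqVneq (k w) 0.
    by rewrite kw0 mule0; under eq_fun do rewrite mule0; exact: cvg_cst.
  apply: cvgeM => //; last exact: cvg_cst.
  by rewrite mule_defE (negPf hw0) (negPf kw0).
rewrite !step//; congr (limn _); apply/funext => n.
pose s := finmap.enum_fset (fset_set (range (a n))).
have aE w : (a n w)%:E = \sum_(i < size s) (s`_i)%:E * (\1_(a n @^-1` [set s`_i]) w)%:E.
  by rewrite (fimfunEord (a n) w) -sumEFin.
have ranges (i : 'I_(size s)) : (0 <= s`_i)%R.
  have : s`_i \in fset_set (range (a n)) by exact: mem_nth.
  by rewrite in_fset_set// => /set_mem [w _ <-].
have Gpre (y : R) : G (a n @^-1` [set y]).
  have := measurable_funP (a n) measurableT _ (measurable_set1 y).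
  by rewrite setTI measurable_g_measurableTypeE.
have indE (m : {measure set Omega -> \bar R}) (k : Omega -> \bar R) :
    measurable_fun setT k -> (forall w, 0 <= k w) ->
    \int[m]_w ((a n w)%:E * k w) =
    \sum_(i < size s) (s`_i)%:E * \int[m]_(w in a n @^-1` [set s`_i]) k w.
  move=> mk k0.
  have mi (i : 'I_(size s)) : measurable_fun [set: Omega]
      (fun w => (\1_(a n @^-1` [set s`_i]) w)%:E * k w).
    apply: emeasurable_funM => //; exact/measurable_indicE/GM.
  under eq_integral => w _.
    rewrite aE ge0_sume_distrl; last first.
      by move=> i _; rewrite mule_ge0// lee_fin.
    under eq_bigr do rewrite -muleA.
    over.
  rewrite ge0_integral_sum//; last 2 first.
  - by move=> i; apply: emeasurable_funM => //; exact: mi.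
  - by move=> i w _; rewrite !mule_ge0// lee_fin.
  apply: eq_bigr => i _; rewrite ge0_integralZl//; last 2 first.
  - by move=> w _; rewrite mule_ge0// lee_fin.
  - by rewrite lee_fin.
  congr (_ * _); rewrite [RHS]integral_mkcond; apply: eq_integral => w _.
  by rewrite patchE indicE; case: ifP => _; rewrite ?mul1e ?mul0e.
by rewrite !indE//; apply: eq_bigr => i _; rewrite fg.
Qed.

(** Yields almost sure uniqueness of conditional expectations, also when the integrals are infinite.
    The identity map pushes [mu] to [OmegaG], where equal integrals over all measurable sets force
    equality. *)
Lemma ge0_ae_eq_sub (mu : {finite_measure set Omega -> \bar R})
    (Y W : Omega -> \bar R) :
  G_measurable G Y -> G_measurable G W ->
  (forall w, 0 <= Y w) -> (forall w, 0 <= W w) ->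
  (forall A, G A -> \int[mu]_(w in A) Y w = \int[mu]_(w in A) W w) ->
  {ae mu, forall w, Y w = W w}.
Proof.
move=> /G_measurableP mY /G_measurableP mW Y0 W0 YW.
have mid : measurable_fun [set: Omega] (idfun : Omega -> OmegaG).
  apply: sub_measurable_fun; exact: measurable_id.
pose push := (pushforward mu (idfun : Omega -> OmegaG) : {measure set OmegaG -> \bar R}).
pose m := push mid.
have intm A (k : Omega -> \bar R) : G A -> measurable_fun [set: OmegaG] k ->
    (forall w, 0 <= k w) -> \int[m]_(w in A) k w = \int[mu]_(w in A) k w.
  move=> GA mk k0; rewrite ge0_integral_pushforward//.
    by rewrite measurable_g_measurableTypeE.
  exact: measurable_funTS.
(* Cutting down to [U <= n] makes [U] integrable, since the measure is finite. *)
have key (U V : OmegaG -> \bar R) n : measurable_fun setT U -> measurable_fun setT V ->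
    (forall w, 0 <= U w) -> (forall w, 0 <= V w) ->
    (forall A, G A -> \int[mu]_(w in A) U w = \int[mu]_(w in A) V w) ->
    ae_eq m [set w | U w <= n%:R%:E] U V.
  move=> mU mV U0 V0 UV.
  have mD : measurable [set w | U w <= n%:R%:E].
    rewrite -[X in measurable X]setTI; apply: measurable_lee => //.
  apply: integral_ae_eq => //.
  - apply/integrableP; split; first exact: measurable_funTS.
    apply: (@le_lt_trans _ _ (\int[m]_(w in [set w | U w <= n%:R%:E]) (cst n%:R%:E) w)).
      apply: ge0_le_integral => //.
      - by apply: measurableT_comp => //; exact: measurable_funTS.
      - by move=> w /=; rewrite gee0_abs.
    rewrite integral_cst//= lte_mul_pinfty// ?lee_fin//.
    rewrite /m /pushforward ltey_eq fin_num_measure//.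
    by apply: GM; rewrite -(measurable_g_measurableTypeE sG).
  - exact: measurable_funTS.
  - by move=> E _ mE; rewrite measurable_g_measurableTypeE// in mE; rewrite !intm// UV.
have : \forall w \ae m, Y w = W w.
  (* Applying [key] in both orders covers the points where [Y] or [W] is finite; elsewhere both are
     [+oo]. *)
  have h1 := ae_foralln (fun n => key Y W n mY mW Y0 W0 YW).
  have h2 := ae_foralln (fun n => key W Y n mW mY W0 Y0 (fun A GA => esym (YW A GA))).
  apply: filterS2 h1 h2 => w h1 h2.
  have bnd (x : \bar R) : 0 <= x -> x = +oo \/ exists n, x <= n%:R%:E.
    case: x => [r|_|//]; last by left.
    by rewrite lee_fin => r0; right; exists (Num.truncn r).+1; rewrite lee_fin ltW// truncnS_gt.
  have [Yoo|[n Yn]] := bnd _ (Y0 w); last exact: h1 Yn.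
  have [Woo|[n Wn]] := bnd _ (W0 w); last exact/esym/(h2 n).
  by rewrite Yoo Woo.
move=> [N [mN N0 sN]]; exists N; split => //.
by apply: GM; rewrite -(measurable_g_measurableTypeE sG).
Qed.

End sub_sigma_algebra.

Lemma integral_indicM d0 (Omega : measurableType d0) (R : realType)
    (mu : {measure set Omega -> \bar R}) (A : set Omega) (f : Omega -> \bar R) :
  \int[mu]_(w in A) f w = \int[mu]_w ((\1_A w)%:E * f w).
Proof.
rewrite integral_mkcond; apply: eq_integral => w _.
by rewrite patchE indicE; case: ifP => _; rewrite ?mul1e ?mul0e.
Qed.

(** * Probabilities from densities and mixtures *)

Lemma probability_with_density d0 (Omega : measurableType d0) (R : realType)
    (mu : {measure set Omega -> \bar R}) (f : Omega -> \bar R) :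
  measurable_fun setT f -> (forall w, 0 <= f w) -> \int[mu]_w f w = 1 ->
  exists P : probability Omega R,
    forall A, measurable A -> P A = \int[mu]_(w in A) f w.
Proof.
move=> mf f0 f1; pose m A := \int[mu]_(w in A) f w.
have m0 : m set0 = 0 by rewrite /m integral_set0.
have mge0 A : 0 <= m A by exact: integral_ge0.
have madd : semi_sigma_additive m.
  move=> F mF tF mUF; rewrite /m ge0_integral_bigcup//; last exact: measurable_funTS.
  by apply: is_cvg_ereal_nneg_natsum => n _; exact: integral_ge0.
have m1 : m setT = 1 by [].
pose M : {measure set Omega -> \bar R} := HB.pack m
  (isMeasure.Build _ _ _ m m0 mge0 madd).
pose P : probability Omega R := HB.pack (Measure.sort M)
  (Measure_isProbability.Build _ _ _ (Measure.sort M) m1).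
by exists P.
Qed.

Lemma mule_cancel (R : realType) (c : R) (x y : \bar R) : (0 < c)%R ->
  c%:E * x = c%:E * y -> x = y.
Proof.
move=> c0 e; rewrite -[x]mul1e -[y]mul1e -[1](_ : (c^-1 * c)%:E = _).
  by rewrite EFinM -!muleA e.
by rewrite mulVf// gt_eqF.
Qed.

Lemma probability_mixture d0 (Omega : measurableType d0) (R : realType) (d : nat)
    (c : 'I_d -> R) (Qs : 'I_d -> probability Omega R) :
  (forall i, 0 <= c i)%R -> (\sum_i c i = 1)%R ->
  exists Q : probability Omega R,
    forall A f, measurable A -> measurable_fun setT f -> (forall w, 0 <= f w) ->
    \int[Q]_(w in A) f w = \sum_(i < d) (c i)%:E * \int[Qs i]_(w in A) f w.
Proof.
move=> c0 c1; case: d c Qs c0 c1 => [c Qs c0|d c Qs c0 c1].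
  by rewrite big_ord0 => /eqP; rewrite eq_sym oner_eq0.
(* [msum] is indexed by naturals, hence the passage through [inord]. *)
pose m n := mscale (NngNum (c0 (inord n))) (Qs (inord n)).
pose M := msum m d.+1.
have ME A f : measurable A -> measurable_fun setT f -> (forall w, 0 <= f w) ->
    \int[M]_(w in A) f w = \sum_(i < d.+1) (c i)%:E * \int[Qs i]_(w in A) f w.
  move=> mA mf f0; have mfA := measurable_funTS mf.
  rewrite ge0_integral_measure_sum//; apply: eq_bigr => i _.
  by rewrite ge0_integral_mscale//= inord_val.
(* The density one repackages [M] as a probability; its mass is the sum of the weights. *)
have [|||P PE] := @probability_with_density _ Omega R M (cst 1) => //.
  rewrite ME//; transitivity (\sum_(i < d.+1) (c i)%:E); last by rewrite sumEFin c1.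
  apply: eq_bigr => i _; rewrite integral_cst// mul1e -[RHS]mule1; congr (_ * _).
  exact: probability_setT.
have PM A : measurable A -> P A = M A.
  by move=> mA; rewrite PE// integral_cst// mul1e.
exists P => A f mA mf f0; rewrite -ME//.
by apply: eq_measure_integral => B mB _; exact: PM.
Qed.

(** * Basket measures and numeraire families *)

Section exchange_market.
Context (R : realType) (d0 : measure_display) (Omega : measurableType d0)
  (T : R) (d : nat) (F : R -> set (set Omega))
  (S : R -> Omega -> 'I_d -> 'I_d -> \bar R).
Hypotheses (hT : (0 < T)%R) (hd : (0 < d)%N).
Hypotheses (hF : filtration T F) (hS : exchange_process T F S).

Local Notation price t w i := (basket_price (S t w) i).

Lemma filtration_sigma t : (0 <= t <= T)%R -> sigma_algebra setT (F t).
Proof. by case: hF => h _; exact: h. Qed.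

Lemma filtration_top A : F T A <-> measurable A.
Proof. by case: hF => _ [h _]; exact: h. Qed.

Lemma filtration_le s t : (0 <= s <= t)%R -> (t <= T)%R -> F s `<=` F t.
Proof. by case: hF => _ [_ [h _]]; exact: h. Qed.

Lemma filtration_measurable t : (0 <= t <= T)%R -> F t `<=` measurable.
Proof. by move=> tT A FA; apply/filtration_top; apply: filtration_le FA => //; case/andP: tT. Qed.

Lemma filtration_trivial A : F 0%R A -> A = set0 \/ A = setT.
Proof. by case: hF => _ [_ [_ [_ h]]]; exact: h. Qed.

Lemma horizon0 : (0 <= (0 : R) <= T)%R. Proof. by rewrite lexx ltW. Qed.
Lemma horizonT : (0 <= T <= T)%R. Proof. by rewrite lexx ltW. Qed.

Lemma exchange_matrix_at t w : (0 <= t <= T)%R -> exchange_matrix (S t w).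
Proof. by case: hS => h _; exact: h. Qed.

Lemma exchange_measurable t i j : (0 <= t <= T)%R ->
  G_measurable (F t) (fun w => S t w i j).
Proof. by case: hS => _ [h _]; exact: h. Qed.

Lemma active0 w i : active (S 0%R w) i.
Proof. by case: hS => _ [_ [_ h]]; exact: h. Qed.

Lemma exchange_ge0 t w i j : (0 <= t <= T)%R -> 0 <= S t w i j.
Proof. by move=> /(exchange_matrix_at w) h; exact: exch_ge0. Qed.

(** * Deterministic prices at time zero *)

(** A level set of the initial quote lies in the trivial [F 0] and contains [w'], so it is
    everything. *)
Lemma exchange0_cst w w' i j : S 0%R w i j = S 0%R w' i j.
Proof.
have : F 0%R ((fun w => S 0%R w i j) @^-1` [set S 0%R w' i j]).
  by apply: exchange_measurable; [exact: horizon0|exact: emeasurable_set1].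
move=> /filtration_trivial[e|e].
- by have : set0 w' by rewrite -e.
- by have : setT w by []; rewrite -e.
Qed.

(** The choice of [point] is immaterial, as initial quotes do not depend on the state. *)
Definition price0 (i : 'I_d) : R := price 0%R point i.

Lemma price0E w i : price 0%R w i = price0 i.
Proof.
rewrite /price0 /basket_price; congr (fine _)^-1%R.
by apply: eq_bigr => j _; exact: exchange0_cst.
Qed.

Lemma price0_gt0 i : (0 < price0 i)%R.
Proof. by rewrite basket_price_gt0 ?active0//; exact: exchange_matrix_at horizon0. Qed.

Lemma price0_mul w i j : (price0 i)%:E * S 0%R w i j = (price0 j)%:E.
Proof.
rewrite -!(price0E w) basket_price_mul//; last exact: active0.
exact: exchange_matrix_at horizon0.
Qed.

Lemma exchange0_fin w i j : S 0%R w i j \is a fin_num.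
Proof.
rewrite ge0_fin_numE; last exact: exchange_ge0 horizon0.
by have /activeP := active0 w i; apply; exact: exchange_matrix_at horizon0.
Qed.

Lemma price0_sum : (\sum_i price0 i = 1)%R.
Proof. by apply: basket_price_sum => //; exact: exchange_matrix_at horizon0. Qed.

(** * Measurability of basket prices *)

Lemma price_ge0 t w i : (0 <= t <= T)%R -> (0 <= price t w i)%R.
Proof. by move=> tT; apply: basket_price_ge0; exact: exchange_matrix_at. Qed.

Lemma sum_exchange_measurable t i : (0 <= t <= T)%R ->
  G_measurable (F t) (fun w => \sum_j S t w i j).
Proof.
move=> tT; apply: G_measurable_sum; first exact: filtration_sigma.
by move=> j; exact: exchange_measurable.
Qed.

Lemma price_measurable t i : (0 <= t <= T)%R ->
  G_measurable_real (F t) (fun w => price t w i).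
Proof.
move=> tT; apply: G_measurable_inv; first exact: filtration_sigma.
  by move=> w; rewrite fine_ge0// sume_ge0// => j _; exact: exchange_ge0.
apply: G_measurable_fine; first exact: filtration_sigma.
exact: sum_exchange_measurable.
Qed.

Lemma eprice_measurable t i : (0 <= t <= T)%R ->
  G_measurable (F t) (fun w => (price t w i)%:E).
Proof.
move=> tT; apply: G_measurable_EFin; first exact: filtration_sigma.
exact: price_measurable.
Qed.

Lemma adapted_measurable_fun t (h : Omega -> \bar R) : (0 <= t <= T)%R -> G_measurable (F t) h ->
  measurable_fun [set: Omega] h.
Proof.
move=> tT; apply: G_measurable_fun; first exact: filtration_sigma.
exact: filtration_measurable.
Qed.

Lemma terminal_G_measurable (h : Omega -> \bar R) :
  measurable_fun [set: Omega] h -> G_measurable (F T) h.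
Proof.
by move=> mh B mB; apply/filtration_top; rewrite -[X in measurable X]setTI; exact: mh.
Qed.

(** * The number of active currencies *)

Definition inv_nactive (w : Omega) : R := ((nactive S T w)%:R^-1)%R.

Lemma nactiveE w : nactive S T w = #|[pred i | active (S T w) i]|.
Proof. by []. Qed.

Lemma nactive_gt0 w : (0 < nactive S T w)%N.
Proof.
rewrite nactiveE; have [i ai] := active_ex (exchange_matrix_at w horizonT) hd.
by apply/card_gt0P; exists i.
Qed.

Lemma inv_nactive_ge0 w : (0 <= inv_nactive w)%R.
Proof. by rewrite invr_ge0. Qed.

Lemma inv_nactive_measurable : G_measurable (F T) (fun w => (inv_nactive w)%:E).
Proof.
have sFT := filtration_sigma horizonT.
apply: G_measurable_EFin => //; apply: G_measurable_inv => //.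
(* The count is a sum of indicators of the events that a row sum is finite. *)
have -> : (fun w => (nactive S T w)%:R%R) =
    (fun w => fine (\sum_i (\1_[set w | (\sum_j S T w i j < +oo)%E] w : R)%:E)).
  apply/funext => w; rewrite sumEFin/= nactiveE -sum1_card natr_sum big_mkcond/=.
  apply: eq_bigr => i _; rewrite indicE /active.
  by case: ifPn => h; [rewrite mem_set|rewrite memNset//; apply/negP].
apply: G_measurable_fine => //; apply: G_measurable_sum => // i.
apply: G_measurable_indic => //; apply: G_measurable_lt.
exact: sum_exchange_measurable horizonT.
Qed.

Lemma sum_active_eq (w : Omega) (f : 'I_d -> \bar R) (x : \bar R) :
  (forall j, active (S T w) j -> f j = x) ->
  (inv_nactive w)%:E * (\sum_(j < d | active (S T w) j) f j) = x.
Proof.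
move=> fx; rewrite (eq_bigr (fun _ => x)); last by move=> j /fx.
have -> : \sum_(j < d | active (S T w) j) x = (nactive S T w)%:R%:E * x.
  (* Reconciles the iterated extended-real sum with the multiple of the underlying additive
     structure. *)
  have natmulE n : x *+ n = (x *+ n)%R.
    by elim: n => [|n IHn]; [rewrite mule0n mulr0n|rewrite muleS mulrS IHn].
  by rewrite mule_natl natmulE nactiveE -sumr_const; apply: eq_bigl => j; rewrite inE.
by rewrite muleA -EFinM mulVf ?mul1e// pnatr_eq0 -lt0n nactive_gt0.
Qed.

(** * Change of measure between the basket and the currencies *)

Definition linked (Q : probability Omega R) (Qs : 'I_d -> probability Omega R)
  (t : R) : Prop :=
  forall j A, F t A ->
    \int[Q]_(w in A) (price t w j)%:E = (price0 j)%:E * Qs j A.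

(** Extends the defining relation from sets of [F t] to nonnegative [F t]-measurable integrands,
    taking a constant density on the [Qs j] side. *)
Lemma linked_integral Q Qs t j h : linked Q Qs t -> (0 <= t <= T)%R ->
  G_measurable (F t) h -> (forall w, 0 <= h w) ->
  \int[Q]_w (h w * (price t w j)%:E) = (price0 j)%:E * \int[Qs j]_w h w.
Proof.
move=> lk tT mh h0.
have c0 : (0 <= price0 j)%R by rewrite ltW// price0_gt0.
rewrite (@ge0_integralM_eq _ _ _ (F t) _ _ Q (Qs j) _ (cst (price0 j)%:E))//.
- under eq_integral do rewrite /= muleC.
  by rewrite ge0_integralZl//; exact: adapted_measurable_fun mh.
- exact: filtration_sigma.
- exact: filtration_measurable.
- by apply: adapted_measurable_fun (eprice_measurable _ tT).
- by move=> w; rewrite lee_fin price_ge0.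
- by move=> A FA; rewrite lk// integral_cst//; exact: filtration_measurable FA.
Qed.

(** On a set of [F r] the martingale property replaces the terminal price by the price at [r]. *)
Lemma linked_le Q Qs r : valuation_measure T F S Q -> linked Q Qs T ->
  (0 <= r <= T)%R -> linked Q Qs r.
Proof.
move=> vQ lk /[dup] rT /andP[r0 r1] j A FA.
have [_ [_ mart]] := vQ j.
have := mart r T rT (lexx T) A FA.
under eq_integral do rewrite SbarE.
under [RHS]eq_integral do rewrite SbarE.
by move=> <-; rewrite lk//; exact: filtration_le FA.
Qed.

(** Basket prices sum to one, so adding the relations over [j] leaves the integral of one. *)
Lemma linked_total Q Qs t : linked Q Qs t -> (0 <= t <= T)%R ->
  forall A, F t A -> Q A = \sum_j (price0 j)%:E * Qs j A.
Proof.
move=> lk tT A FA; have mA := filtration_measurable tT FA.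
under eq_bigr do rewrite -lk//.
rewrite -ge0_integral_sum//; last 2 first.
- by move=> j; apply: measurable_funTS; exact: adapted_measurable_fun (eprice_measurable _ tT).
- by move=> j w _; rewrite lee_fin price_ge0.
rewrite (eq_integral (cst 1)) ?integral_cst ?mul1e// => w _.
by rewrite sumEFin basket_price_sum//; exact: exchange_matrix_at.
Qed.

(** [Q] is a mixture of the [Qs j] with strictly positive weights. *)
Lemma linked_equiv Q Qs : linked Q Qs T -> equiv_sum Q Qs.
Proof.
move=> lk A mA; have FA : F T A by exact/filtration_top.
have c0 j : 0 <= (price0 j)%:E by rewrite lee_fin ltW// price0_gt0.
have QE := linked_total lk horizonT FA.
split=> [QA|QsA].
- move: QA; rewrite QE => /eqP; rewrite seq_psume_eq0 => [/allP h|j _]; last exact: mule_ge0.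
  rewrite big1// => j _; apply/eqP; have /implyP/(_ isT) := h j (mem_index_enum j).
  by rewrite mule_eq0 eqe gt_eqF ?price0_gt0.
- rewrite QE big1// => j _; move: QsA => /eqP; rewrite seq_psume_eq0// => /allP h.
  by have /implyP/(_ isT)/eqP -> := h j (mem_index_enum j); rewrite mule0.
Qed.

Lemma linked_consistent Q Qs : (forall t, (0 <= t <= T)%R -> linked Q Qs t) ->
  numeraire_consistent T F S Qs.
Proof.
move=> lkall i j t tT A FA w0; have lk := lkall t tT.
have sF := filtration_sigma tT.
pose B := [set w | 0 < S t w j i].
have FB : F t B by apply: G_measurable_gt; exact: exchange_measurable.
have FAB : F t (A `&` B).
  rewrite -(measurable_g_measurableTypeE sF).
  by apply: measurableI; rewrite measurable_g_measurableTypeE.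
(* The factor [price0 i] turns [S 0 i j] into [price0 j]; both sides then become integrals under
   [Q], whose integrands agree by [basket_price_mul_gt0]. *)
apply: (mule_cancel (price0_gt0 i)).
rewrite muleA price0_mul -lk// integral_indicM -(linked_integral _ lk)//; first last.
- by move=> w; rewrite mule_ge0 ?lee_fin// exchange_ge0.
- by apply: G_measurableM => //; [exact: G_measurable_indic|exact: exchange_measurable].
rewrite [RHS]integral_indicM; apply: eq_integral => w _.
rewrite indicI EFinM -!muleA; congr (_ * _).
rewrite muleC basket_price_mul_gt0; last exact: exchange_matrix_at.
rewrite muleC indicE (_ : (w \in B) = (0 < S t w j i))//.
by apply/idP/idP => [/set_mem|h]; last exact/mem_set.
Qed.

(** * The valuation formulas *)

(** Inactive currencies have price zero, and [0 * +oo = 0] removes their terms even when [f j] is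
    infinite. *)
Lemma sum_inactive_price t (w : Omega) (f : 'I_d -> \bar R) : (0 <= t <= T)%R ->
  \sum_(j < d | activeb S t w j) ((Sbar S t w j)%:E * f j) =
  \sum_(j < d) (f j * (price t w j)%:E).
Proof.
move=> tT; rewrite big_mkcond; apply: eq_bigr => j _; rewrite SbarE muleC.
by case: ifPn => // naj; rewrite basket_price_inactive ?mule0.
Qed.

Lemma CbarE (C : Omega -> 'I_d -> \bar R) w : (forall j, 0 <= C w j) ->
  Cbar S T C w = \sum_(j < d) (C w j * (inv_nactive w)%:E * (price T w j)%:E).
Proof.
move=> C0; rewrite /Cbar sum_inactive_price; last exact: horizonT.
rewrite ge0_sume_distrr; last first.
  by move=> j _; rewrite mule_ge0// lee_fin price_ge0//; exact: horizonT.
by apply: eq_bigr => j _; rewrite muleA (muleC (C w j)).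
Qed.

Lemma Cbar_active (C : Omega -> 'I_d -> \bar R) w i :
  value_vector (S T w) (C w) -> active (S T w) i ->
  Cbar S T C w = C w i * (price T w i)%:E.
Proof.
move=> vC ai; rewrite /Cbar; apply: sum_active_eq => j aj; rewrite SbarE.
rewrite [RHS]muleC; apply: basket_value_active => //.
exact: exchange_matrix_at horizonT.
Qed.

Lemma claim_ge0 C w j : claim T S C -> 0 <= C w j.
Proof. by move=> [_ vC]; case: (vC w). Qed.

Lemma claim_measurable C j : claim T S C -> G_measurable (F T) (fun w => C w j).
Proof. by move=> [mC _]; exact: terminal_G_measurable. Qed.

Lemma share_measurable C j : claim T S C ->
  G_measurable (F T) (fun w => C w j * (inv_nactive w)%:E).
Proof.
move=> cC; apply: G_measurableM; first exact: filtration_sigma horizonT.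
  exact: claim_measurable.
exact: inv_nactive_measurable.
Qed.

Lemma share_ge0 C w j : claim T S C -> 0 <= C w j * (inv_nactive w)%:E.
Proof. by move=> cC; rewrite mule_ge0 ?claim_ge0// lee_fin inv_nactive_ge0. Qed.

(** Both sides are [F r]-measurable, so equal integrals over the sets of [F r] suffice, and these
    are compared currency by currency. *)
Lemma linked_star Q Qs r C : linked Q Qs T -> (0 <= r <= T)%R -> linked Q Qs r ->
  claim T S C -> star T F S Q Qs r C.
Proof.
move=> lkT rT lkr cC Y Z [mY [Y0 intY]] cZ.
have sF := filtration_sigma rT; have sFT := filtration_sigma horizonT.
have mZ j : G_measurable (F r) (Z j) by case: (cZ j).
have Z0 j w : 0 <= Z j w by case: (cZ j) => _ [].
pose W w := \sum_(j < d) (Z j w * (price r w j)%:E).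
have WE w : \sum_(j < d | activeb S r w j) ((Sbar S r w j)%:E * Z j w) = W w.
  exact: sum_inactive_price.
have mterm j : G_measurable (F r) (fun w => Z j w * (price r w j)%:E).
  by apply: G_measurableM => //; exact: eprice_measurable.
have term0 j w : 0 <= Z j w * (price r w j)%:E.
  by rewrite mule_ge0// lee_fin price_ge0.
suff : {ae Q, forall w, Y w = W w}.
  by apply: filterS => w ->; rewrite WE.
apply: (ge0_ae_eq_sub sF (filtration_measurable rT)) => //.
- exact: G_measurable_sum.
- by move=> w; rewrite sume_ge0.
move=> A FA; rewrite intY//; have mA := filtration_measurable rT FA.
have FTA : F T A by exact/filtration_top.
rewrite ge0_integral_sum//; last first.
  by move=> j; apply: measurable_funTS; exact: adapted_measurable_fun (mterm j).
rewrite (eq_integral (fun w => \sum_(j < d)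
    (C w j * (inv_nactive w)%:E * (price T w j)%:E))); last first.
  by move=> w _; rewrite CbarE// => j; exact: claim_ge0.
rewrite ge0_integral_sum//; last 2 first.
- move=> j; apply: measurable_funTS; apply: (adapted_measurable_fun horizonT).
  apply: G_measurableM => //; first exact: share_measurable.
  exact: eprice_measurable horizonT.
- move=> j w _; rewrite mule_ge0 ?share_ge0// lee_fin price_ge0//.
  exact: horizonT.
(* The left term passes to [Qs j] by the relation at [T], the right one by the relation at [r]; the
   definition of [Z j] identifies the results. *)
apply: eq_bigr => j _; rewrite [LHS]integral_indicM [RHS]integral_indicM.
under eq_integral do rewrite muleA.
under [RHS]eq_integral do rewrite muleA.
rewrite (linked_integral _ lkT horizonT); first last.
- by move=> w; rewrite mule_ge0 ?share_ge0// lee_fin.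
- by apply: G_measurableM => //; [exact: G_measurable_indic|exact: share_measurable].
rewrite (linked_integral _ lkr rT); first last.
- by move=> w; rewrite mule_ge0// lee_fin.
- by apply: G_measurableM => //; exact: G_measurable_indic.
rewrite -!integral_indicM; congr (_ * _).
by have [_ [_ ->]] := cZ j.
Qed.

(** The support condition reduces [Cbar] almost surely to [C i] times the price of [i], so a single
    change of measure replaces the sum over currencies. *)
Lemma linked_single Q Qs r C i Y Z : linked Q Qs T -> (0 <= r <= T)%R ->
  linked Q Qs r -> claim T S C ->
  {ae Q, forall w,
     Cbar S T C w = Cbar S T C w * (if activeb S T w i then 1 else 0)} ->
  is_condexp Q (F r) (Cbar S T C) Y ->
  is_condexp (Qs i) (F r) (fun w => C w i) Z ->
  {ae Q, forall w, Y w = (Sbar S r w i)%:E * Z w}.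
Proof.
move=> lkT rT lkr cC suppC [mY [Y0 intY]] [mZ [Z0 intZ]].
have sF := filtration_sigma rT; have sFT := filtration_sigma horizonT.
suff : {ae Q, forall w, Y w = Z w * (price r w i)%:E}.
  by apply: filterS => w ->; rewrite SbarE muleC.
apply: (ge0_ae_eq_sub sF (filtration_measurable rT)) => //.
- by apply: G_measurableM => //; exact: eprice_measurable.
- by move=> w; rewrite mule_ge0// lee_fin price_ge0.
move=> A FA; rewrite intY//; have mA := filtration_measurable rT FA.
have FTA : F T A by exact/filtration_top.
have mCp : G_measurable (F T) (fun w => C w i * (price T w i)%:E).
  by apply: G_measurableM => //; [exact: claim_measurable|exact: eprice_measurable horizonT].
have C0 w : 0 <= C w i by exact: claim_ge0.
have pT0 w : 0 <= (price T w i)%:E by rewrite lee_fin price_ge0//; exact: horizonT.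
have mCbar : measurable_fun [set: Omega] (Cbar S T C).
  rewrite (_ : Cbar S T C = fun w => \sum_(j < d)
    (C w j * (inv_nactive w)%:E * (price T w j)%:E)).
    apply: (adapted_measurable_fun horizonT); apply: G_measurable_sum => // j.
    apply: G_measurableM => //; first exact: share_measurable.
    exact: eprice_measurable horizonT.
  by apply/funext => w; rewrite CbarE// => j; exact: claim_ge0.
have Cbar0 w : 0 <= Cbar S T C w.
  rewrite CbarE; last by move=> j; exact: claim_ge0.
  rewrite sume_ge0// => j _; rewrite mule_ge0 ?share_ge0// lee_fin price_ge0//.
  exact: horizonT.
rewrite (ge0_ae_eq_integral (g := fun w => C w i * (price T w i)%:E))//; first last.
(* Where [i] is inactive both sides vanish: the left by the support condition, the right because the
   price is zero. *)
- apply: filterS suppC => w ->; rewrite -/(active (S T w) i) => _.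
  case: ifPn => [ai|nai].
    by rewrite mule1; apply: Cbar_active => //; case: cC.
  by rewrite mule0 basket_price_inactive ?mule0.
- by move=> w _; exact: mule_ge0.
- by apply: measurable_funTS; exact: adapted_measurable_fun horizonT mCp.
- exact: measurable_funTS.
rewrite [LHS]integral_indicM [RHS]integral_indicM.
under eq_integral do rewrite muleA.
under [RHS]eq_integral do rewrite muleA.
rewrite (linked_integral _ lkT horizonT); first last.
- by move=> w; rewrite mule_ge0// lee_fin.
- by apply: G_measurableM => //; [exact: G_measurable_indic|exact: claim_measurable].
rewrite (linked_integral _ lkr rT); first last.
- by move=> w; rewrite mule_ge0// lee_fin.
- by apply: G_measurableM => //; exact: G_measurable_indic.
by rewrite -!integral_indicM intZ.
Qed.


(** * From numeraire consistency to linked measures *)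

(** Consistency extended from sets to nonnegative integrands, made symmetric by
    [price0 k * S 0 k j = price0 j]. *)
Lemma consistent_integral Qs t (h : Omega -> \bar R) k j :
  numeraire_consistent T F S Qs -> (0 <= t <= T)%R ->
  G_measurable (F t) h -> (forall w, 0 <= h w) ->
  (price0 k)%:E * \int[Qs k]_w (h w * S t w k j) =
  (price0 j)%:E * \int[Qs j]_w (h w * (0 < S t w j k)%E%:R%:E).
Proof.
move=> cons tT mh h0; have sF := filtration_sigma tT.
pose B := [set w | 0 < S t w j k].
have FB : F t B by apply: G_measurable_gt; exact: exchange_measurable.
have mB := filtration_measurable tT FB.
have BE w : (0 < S t w j k)%E%:R%:E = (\1_B w)%:E :> \bar R.
  rewrite indicE (_ : (w \in B) = (0 < S t w j k)%E)//.
  by apply/idP/idP => [/set_mem//|?]; exact/mem_set.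
have S00 : 0 <= S 0%R point k j by exact: exchange_ge0 horizon0.
have mhT := adapted_measurable_fun tT mh.
rewrite (@ge0_integralM_eq _ _ _ (F t) sF (filtration_measurable tT) (Qs k) (Qs j) _
    (fun w => S 0%R point k j * (\1_B w)%:E))//.
- under eq_integral do rewrite muleCA.
  rewrite ge0_integralZl//; last 2 first.
  + by apply: emeasurable_funM => //; exact: measurable_indicE.
  + by move=> w _; rewrite mule_ge0// lee_fin.
  rewrite muleA price0_mul; congr (_ * _).
  by apply: eq_integral => w _; rewrite BE.
- by apply: (adapted_measurable_fun tT); exact: exchange_measurable.
- by apply: emeasurable_funM; [exact: measurable_cst|exact: measurable_indicE].
- by move=> w; exact: exchange_ge0.
- by move=> w; rewrite mule_ge0// lee_fin.
move=> A FA; have mA := filtration_measurable tT FA.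
rewrite (cons k j t tT A FA point) ge0_integralZl//.
- by rewrite integral_indic// setIC.
- by apply: measurable_funTS; exact: measurable_indicE.
Qed.

(** Consistency on the whole space bounds the integral by the finite initial quote. *)
Lemma exchange_integrable Qs t k j :
  numeraire_consistent T F S Qs -> (0 <= t <= T)%R ->
  (Qs k).-integrable setT (fun w => S t w k j).
Proof.
move=> cons tT; have sF := filtration_sigma tT.
apply/integrableP; split.
  by apply: (adapted_measurable_fun tT); exact: exchange_measurable.
under eq_integral do rewrite gee0_abs ?exchange_ge0//.
rewrite (cons k j t tT setT _ point); last first.
  by rewrite -(measurable_g_measurableTypeE sF).
rewrite lte_mul_pinfty ?exchange0_fin//; first exact: exchange_ge0 horizon0.
apply: (@le_lt_trans _ _ 1); last exact: ltry.
apply: probability_le1; rewrite setTI; apply: (filtration_measurable tT).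
by apply: G_measurable_gt; exact: exchange_measurable.
Qed.

(** The row sum of [i] is integrable under [Qs i], hence finite: a currency stays active under its
    own measure. *)
Lemma ae_active Qs t i : numeraire_consistent T F S Qs -> (0 <= t <= T)%R ->
  {ae Qs i, forall w, active (S t w) i}.
Proof.
move=> cons tT.
have : (Qs i).-integrable setT (fun w => \sum_j S t w i j).
  by apply: integrable_sum => // j _; exact: exchange_integrable.
move/(integrable_ae measurableT); apply: filterS => w /(_ I).
by rewrite /active fin_numElt => /andP[].
Qed.

Lemma consistent_linked (Q : probability Omega R) Qs t : numeraire_consistent T F S Qs ->
  (forall A f, measurable A -> measurable_fun setT f -> (forall w, 0 <= f w) ->
    \int[Q]_(w in A) f w = \sum_k (price0 k)%:E * \int[Qs k]_(w in A) f w) ->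
  (0 <= t <= T)%R -> linked Q Qs t.
Proof.
move=> cons QE tT j A FA; have sF := filtration_sigma tT.
have mA := filtration_measurable tT FA.
have mp k : measurable_fun setT (fun w => (price t w k)%:E).
  exact: adapted_measurable_fun (eprice_measurable _ tT).
have p0 w k : 0 <= (price t w k)%:E by rewrite lee_fin price_ge0.
have mAp k : G_measurable (F t) (fun w => (\1_A w)%:E * (price t w k)%:E).
  by apply: G_measurableM => //; [exact: G_measurable_indic|exact: eprice_measurable].
have Ap0 k w : 0 <= (\1_A w)%:E * (price t w k)%:E by rewrite mule_ge0// lee_fin.
have mApT k := adapted_measurable_fun tT (mAp k).
have mS k l : measurable_fun setT (fun w => S t w k l).
  by apply: (adapted_measurable_fun tT); exact: exchange_measurable.
rewrite QE//.
transitivity (\sum_k (price0 j)%:E * \int[Qs j]_w ((\1_A w)%:E * (price t w k)%:E)).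
  apply: eq_bigr => k _; rewrite integral_indicM.
  (* Under [Qs k] currency [k] is active, so the price of [j] is the price of [k] times [S t w k j];
     consistency then moves the term to [Qs j]. *)
  rewrite (ge0_ae_eq_integral (g := fun w => (\1_A w)%:E * (price t w k)%:E * S t w k j))//;
    first last.
  - apply: filterS (ae_active k cons tT) => w ak _.
    by rewrite -muleA basket_price_mul//; exact: exchange_matrix_at.
  - by move=> w _; rewrite mule_ge0// exchange_ge0.
  - exact: emeasurable_funM.
  rewrite consistent_integral//; congr (_ * _).
  apply: eq_integral => w _.
  have [ak|nak] := boolP (active (S t w) k).
    have eS := exchange_matrix_at w tT.
    by rewrite exch_gt0// (activeP eS _ ak) mule1.
  by rewrite (basket_price_inactive nak) !mule0 mul0e.
rewrite -ge0_sume_distrr; last by move=> k _; exact: integral_ge0.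
congr (_ * _); rewrite -ge0_integral_sum//.
transitivity (\int[Qs j]_w (\1_A w)%:E); last by rewrite integral_indic// setIT.
apply: eq_integral => w _; rewrite -ge0_sume_distrr//.
by rewrite sumEFin basket_price_sum ?mule1//; exact: exchange_matrix_at.
Qed.

(** * Unit claims and recovery of the link *)

(** One unit of currency [i] paid on [A], quoted in currency [k]; a column of an exchange matrix is
    a value vector. *)
Definition unit_claim (i : 'I_d) (A : set Omega) (w : Omega) (k : 'I_d) : \bar R :=
  (\1_A w)%:E * S T w k i.

Lemma claim_unit i A : measurable A -> claim T S (unit_claim i A).
Proof.
move=> mA; split=> [k|w].
  apply: emeasurable_funM; first exact: measurable_indicE.
  by apply: (adapted_measurable_fun horizonT); exact: exchange_measurable horizonT.
have eS := exchange_matrix_at w horizonT.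
rewrite /unit_claim indicE; case: (w \in A) => /=; split => k.
- by rewrite mul1e; exact: exchange_ge0 horizonT.
- by move=> j; rewrite !mul1e; case: (exch_value_vector eS i) => _; apply.
- by rewrite mul0e.
- by move=> j _; rewrite !mul0e mule0.
Qed.

Lemma Cbar_unit i A w : Cbar S T (unit_claim i A) w = (\1_A w)%:E * (price T w i)%:E.
Proof.
apply: sum_active_eq => j aj; rewrite SbarE /unit_claim muleCA basket_price_mul//.
exact: exchange_matrix_at horizonT.
Qed.

(** Conditioning on the trivial [F 0] is plain expectation, possibly infinite. *)
Lemma condexp_trivial (Q : probability Omega R) (X : Omega -> \bar R) :
  (forall w, 0 <= X w) -> is_condexp Q (F 0%R) X (cst (\int[Q]_w X w)).
Proof.
move=> X0; have sF := filtration_sigma horizon0; split; last split.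
- exact: G_measurable_cst.
- by move=> w; exact: integral_ge0.
- move=> A /filtration_trivial[]->; first by rewrite !integral_set0.
  by rewrite integral_cst// -[RHS]mule1; congr (_ * _); exact: probability_setT.
Qed.

(** If [P] failed, the exceptional null set would be the whole space, of mass one. *)
Lemma ae_cst (Q : probability Omega R) (P : Prop) : {ae Q, forall w : Omega, P} -> P.
Proof.
move=> [N [mN N0 sN]]; apply: contrapT => nP.
have NT : N = setT by apply/seteqP; split => // w _; apply: sN.
have := probability_setT Q; rewrite -NT N0 => /esym/eqP; by rewrite onee_eq0.
Qed.

Lemma star_linked Q Qs : numeraire_consistent T F S Qs ->
  (forall i A, measurable A -> star T F S Q Qs 0%R (unit_claim i A)) ->
  linked Q Qs T.
Proof.
move=> cons st i A /filtration_top mA.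
have sFT := filtration_sigma horizonT; have FA : F T A by exact/filtration_top.
have cC := claim_unit i mA.
have C0 w : 0 <= Cbar S T (unit_claim i A) w.
  by rewrite Cbar_unit mule_ge0// lee_fin// price_ge0//; exact: horizonT.
have st0 := st i A mA _ _ (condexp_trivial Q C0)
  (fun j => condexp_trivial (Qs j) (fun w => share_ge0 w j cC)).
pose h w : \bar R := (\1_A w)%:E * (inv_nactive w)%:E.
have mh : G_measurable (F T) h.
  by apply: G_measurableM => //; [exact: G_measurable_indic|exact: inv_nactive_measurable].
have h0 w : 0 <= h w by rewrite mule_ge0// lee_fin// inv_nactive_ge0.
have mhT := adapted_measurable_fun horizonT mh.
pose J j w : \bar R := (0 < S T w i j)%E%:R%:E.
have mJ j : measurable_fun setT (J j).
  pose B := [set w | 0 < S T w i j].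
  rewrite (_ : J j = fun w => (\1_B w)%:E).
    apply: measurable_indicE; apply: (filtration_measurable horizonT).
    by apply: G_measurable_gt; exact: exchange_measurable horizonT.
  apply/funext => w; rewrite /J indicE (_ : (w \in B) = (0 < S T w i j)%E)//.
  by apply/idP/idP => [/set_mem//|?]; exact/mem_set.
have J0 j w : 0 <= J j w by rewrite lee_fin.
have : \int[Q]_w Cbar S T (unit_claim i A) w =
    \sum_(j < d) (price0 i)%:E * \int[Qs i]_w (h w * J j w).
  apply: (@ae_cst Q); apply: filterS st0 => w; rewrite /cst => ->.
  rewrite (sum_inactive_price _ _ horizon0); apply: eq_bigr => j _.
  (* Consistency carries the term for [Qs j] over to [Qs i], trading the quote [S T w j i] for the
     indicator of [S T w i j > 0]. *)
  rewrite price0E muleC -(consistent_integral j i cons horizonT mh h0).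
  congr (_ * _); apply: eq_integral => v _.
  by rewrite /unit_claim muleAC.
under eq_integral do rewrite Cbar_unit.
rewrite -integral_indicM => ->.
rewrite -ge0_sume_distrr; last first.
  by move=> j _; apply: integral_ge0 => w _; rewrite mule_ge0.
congr (_ * _); rewrite -(ge0_integral_sum (Qs i) measurableT (f := fun j w => h w * J j w));
  last 2 first.
- by move=> j; exact: emeasurable_funM.
- by move=> j w _; rewrite mule_ge0.
transitivity (\int[Qs i]_w (\1_A w)%:E); last by rewrite integral_indic// setIT.
apply: ge0_ae_eq_integral => //.
- by apply: emeasurable_sum => j; exact: emeasurable_funM.
- exact: measurable_indicE.
- by move=> w _; rewrite sume_ge0// => j _; rewrite mule_ge0.
(* As [i] is active almost surely under [Qs i], the indicators [J j] count the active currencies,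
   and the factor [inv_nactive] cancels. *)
apply: filterS (ae_active i cons horizonT) => w ai _.
have eS := exchange_matrix_at w horizonT.
rewrite -ge0_sume_distrr// /h -muleA.
rewrite (_ : _ * \sum_(j < d) J j w = 1) ?mule1//.
rewrite -[RHS](sum_active_eq (w := w) (f := fun _ => 1))//; congr (_ * _).
rewrite [RHS]big_mkcond; apply: eq_bigr => j _.
have <- : (0 < S T w i j) = active (S T w) j.
  exact: active_gt0.
by rewrite /J; case: (0 < S T w i j).
Qed.


(** * Existence and uniqueness of linked measures *)

Lemma exists_linked Q : valuation_measure T F S Q -> exists Qs, linked Q Qs T.
Proof.
move=> vQ; have sF0 := filtration_sigma horizon0.
pose f i w : \bar R := ((price0 i)^-1)%:E * (price T w i)%:E.
have mp i : measurable_fun setT (fun w => (price T w i)%:E).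
  exact: adapted_measurable_fun horizonT (eprice_measurable _ horizonT).
have p0 i w : 0 <= (price T w i)%:E by rewrite lee_fin price_ge0//; exact: horizonT.
have c0 i : 0 <= ((price0 i)^-1)%:E by rewrite lee_fin invr_ge0 ltW// price0_gt0.
have intE i A : measurable A ->
    \int[Q]_(w in A) f i w = ((price0 i)^-1)%:E * \int[Q]_(w in A) (price T w i)%:E.
  by move=> mA; rewrite ge0_integralZl//; exact: measurable_funTS.
have ex i : exists P : probability Omega R,
    forall A, measurable A -> P A = \int[Q]_(w in A) f i w.
  apply: probability_with_density.
  - by apply: emeasurable_funM => //; exact: measurable_cst.
  - by move=> w; rewrite mule_ge0.
  - have [_ [_ mart]] := vQ i.
    have F0T : F 0%R setT by rewrite -(measurable_g_measurableTypeE sF0).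
    (* The martingale property from [0] to [T] fixes the mass, so the density [f i] integrates to
       one. *)
    have pT : \int[Q]_w (price T w i)%:E = (price0 i)%:E.
      transitivity (\int[Q]_w (Sbar S T w i)%:E).
        by apply: eq_integral => w _; rewrite SbarE.
      rewrite (mart 0%R T horizon0 (lexx T) setT F0T).
      rewrite -[RHS]mule1 -[X in _ * X](probability_setT Q) -integral_cst//.
      by apply: eq_integral => w _; rewrite SbarE price0E.
    by rewrite intE// pT -EFinM mulVf// gt_eqF// price0_gt0.
have [Qs QsE] := choice ex.
exists Qs => j A /filtration_top mA; rewrite QsE// intE// muleA -EFinM mulfV ?mul1e//.
by rewrite gt_eqF// price0_gt0.
Qed.

Lemma linked_unique_family Q Qs Qs' : linked Q Qs T -> linked Q Qs' T ->
  same_family Qs Qs'.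
Proof.
move=> lk lk' i A /filtration_top FA.
by apply: (mule_cancel (price0_gt0 i)); rewrite -lk// lk'.
Qed.

Lemma linked_unique_basket Q Q' Qs : linked Q Qs T -> linked Q' Qs T ->
  same_measure Q Q'.
Proof.
move=> lk lk' A /filtration_top FA.
by rewrite (linked_total lk horizonT FA) (linked_total lk' horizonT FA).
Qed.

Lemma price_le1 t w i : (0 <= t <= T)%R -> (price t w i <= 1)%R.
Proof. by move=> tT; apply: basket_price_le1; exact: exchange_matrix_at. Qed.

Lemma price_integrable Q t i : (0 <= t <= T)%R ->
  (Q : probability Omega R).-integrable setT (fun w => (price t w i)%:E).
Proof.
move=> tT; apply: (@le_integrable _ _ _ _ _ measurableT _ (cst 1)).
- exact: adapted_measurable_fun (eprice_measurable _ tT).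
- by move=> w _; rewrite gee0_abs ?lee_fin ?price_ge0//= normr1 price_le1.
- exact: finite_measure_integrable_cst.
Qed.

Lemma integrable_indicM (Q : probability Omega R) (A : set Omega) (f : Omega -> \bar R) :
  measurable A -> Q.-integrable setT f ->
  Q.-integrable setT (fun w => (\1_A w)%:E * f w).
Proof.
move=> mA intf; apply: (le_integrable measurableT _ _ intf).
- apply: emeasurable_funM; first exact: measurable_indicE.
  exact: measurable_int intf.
- by move=> w _; rewrite indicE; case: (w \in A); rewrite ?mul1e// mul0e abse0.
Qed.

(** For [A] in [F s], the price integrals at [s] and at [t] both equal [price0 i * Qs i A]. *)
Lemma linked_valuation Q Qs : (forall t, (0 <= t <= T)%R -> linked Q Qs t) ->
  valuation_measure T F S Q.
Proof.
move=> lk i; split; last split.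
- move=> t tT; rewrite (_ : (fun _ => _) = fun w => price t w i).
    exact: price_measurable.
  by apply/funext => w; rewrite SbarE.
- move=> t tT; rewrite (_ : (fun _ => _) = fun w => (price t w i)%:E).
    exact: price_integrable.
  by apply/funext => w; rewrite SbarE.
- move=> s t /andP[s0 st] tT A FA.
  under eq_integral do rewrite SbarE.
  under [RHS]eq_integral do rewrite SbarE.
  rewrite !lk// ?s0 ?(le_trans s0 st) ?(le_trans st tT)//.
  by apply: filtration_le FA => //; rewrite s0.
Qed.

(** Unit claims are admissible test claims here, their basket value being bounded by one. *)
Lemma family_linked Q Qs : family_of T F S Q Qs -> linked Q Qs T.
Proof.
move=> [cons [_ st]]; apply: star_linked => // i A mA.
apply: st; [exact: horizon0|exact: claim_unit|].
rewrite (_ : Cbar _ _ _ = fun w => (\1_A w)%:E * (price T w i)%:E).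
  by apply: integrable_indicM => //; exact: price_integrable horizonT.
by apply/funext => w; rewrite Cbar_unit.
Qed.

(** Here unit claims are admissible because consistency makes the terminal quotes integrable. *)
Lemma basket_linked Q Qs : numeraire_consistent T F S Qs -> basket_of T F S Qs Q ->
  linked Q Qs T.
Proof.
move=> cons [_ [_ st]]; apply: star_linked => // i A mA.
apply: st; [exact: horizon0|exact: claim_unit|move=> k].
by apply: integrable_indicM => //; exact: exchange_integrable cons horizonT.
Qed.

End exchange_market.

Unset Implicit Arguments.

Theorem mainTheorem2 (R : realType) (d0 : measure_display) (Omega : measurableType d0)
  (T : R) (d : nat) (F : R -> set (set Omega))
  (S : R -> Omega -> 'I_d -> 'I_d -> \bar R)
  (hT : (0 < T)%R) (hd : (0 < d)%N)
  (hF : filtration T F) (hS : exchange_process T F S) :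
  (* (a) *)
  (forall Qbar : probability Omega R, valuation_measure T F S Qbar ->
     exists Qs : 'I_d -> probability Omega R,
       family_of T F S Qbar Qs /\
       (forall Qs', family_of T F S Qbar Qs' -> same_family Qs Qs')) /\
  (* (b) *)
  (forall Qs : 'I_d -> probability Omega R, numeraire_consistent T F S Qs ->
     exists Qbar : probability Omega R,
       basket_of T F S Qs Qbar /\
       (forall Qbar', basket_of T F S Qs Qbar' -> same_measure Qbar Qbar')) /\
  (* (c) *)
  (forall (Qbar : probability Omega R) (Qs : 'I_d -> probability Omega R),
     valuation_measure T F S Qbar -> family_of T F S Qbar Qs ->
     forall (r : R) (C : Omega -> 'I_d -> \bar R) (i : 'I_d),
       (0 <= r <= T)%R -> claim T S C ->
       {ae Qbar, forall w,
          Cbar S T C w = Cbar S T C w * (if activeb S T w i then 1 else 0)} ->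
       Qbar.-integrable setT (Cbar S T C) ->
       forall (Y Z : Omega -> \bar R),
         is_condexp Qbar (F r) (Cbar S T C) Y ->
         is_condexp (Qs i) (F r) (fun w => C w i) Z ->
         {ae Qbar, forall w, Y w = (Sbar S r w i)%:E * Z w}).
Proof.
split; last split.
- move=> Q vQ; have [Qs lkT] := exists_linked hT hF hS vQ.
  have lk t (tT : (0 <= t <= T)%R) : linked F S Q Qs t by exact: linked_le lkT tT.
  exists Qs; split; last first.
    move=> Qs' /(family_linked hT hd hF hS) lkT'.
    exact: linked_unique_family lkT lkT'.
  split; first exact: linked_consistent lk.
  split; first exact: linked_equiv lkT.
  by move=> r C rT cC _; apply: linked_star (lk _ rT) cC.
- move=> Qs cons.
  (* The weights are forced: by [linked_total], any linked basket measure is this mixture. *)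
  have [i||Q QE] := @probability_mixture _ Omega R d (price0 S) Qs.
  + exact/ltW/(price0_gt0 hT hS).
  + exact: (price0_sum hT hd hS).
  have lk t (tT : (0 <= t <= T)%R) : linked F S Q Qs t.
    exact: (consistent_linked hT hd hF hS cons QE tT).
  have lkT := lk T (horizonT hT).
  exists Q; split; last first.
    move=> Q' /(basket_linked hT hd hF hS cons) lkT'.
    exact: linked_unique_basket lkT lkT'.
  split; first exact: linked_valuation lk.
  split; first exact: linked_equiv lkT.
  by move=> r C rT cC _; apply: linked_star (lk _ rT) cC.
- move=> Q Qs vQ fQ r C i rT cC suppC _ Y Z cY cZ.
  (* The family is known only through [family_of]; unit claims recover the link at [T], and the
     martingale property brings it to [r]. *)
  have lkT := family_linked hT hd hF hS fQ.
  have lkr := linked_le hF vQ lkT rT.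
  exact: (linked_single hT hd hF hS lkT rT lkr cC suppC cY cZ).
Qed.
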